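(* Let $\vartheta\in[0,1)$ and let $$\Delta\tau_{\mathrm{OPT}}(\vartheta)=\arg\min_{\Delta\tau>0}\ \sup_{(\alpha_1,\alpha_2)\in\mathrm{HIGH}}\left|G(\alpha_1,\alpha_2,\vartheta,\Delta\tau)\right|$$ be the optimal relaxation parameter for Dirichlet boundary conditions in 3D. Then $$\Delta\tau_{\mathrm{OPT}}(\vartheta)=\frac{2}{G_0^{\min}(\vartheta)+G_0^{\max}(\vartheta)},$$ where $G_0^{\min}(\vartheta)$ and $G_0^{\max}(\vartheta)$ are respectively the minimum and the maximum of the set $$\left\{\,|G_0(\pi/2,0,\vartheta)|,\ |G_0(\pi/2,\pi/2,\vartheta)|,\ |G_0(\pi,\pi,\vartheta)|\,\right\}.$$
   Context: Let $\mathrm{LOW}=[0,\pi/2]^2$ and $\mathrm{HIGH}=[0,\pi]^2\setminus\mathrm{LOW}$. For $(\alpha_1,\alpha_2)\in[0,\pi]^2$ put $p(\alpha_1,\alpha_2)=\cosh^{-1}(3-\cos\alpha_1-\cos\alpha_2)$, where $\cosh^{-1}:[1,\infty)\to[0,\infty)$ is the inverse of $\cosh$ on $[0,\infty)$. For $\vartheta\in[0,1)$ define the Dirichlet coefficients $$c_{-2}(\vartheta)=\tfrac{\vartheta(\vartheta-1)}{2},\quad c_{-1}(\vartheta)=\vartheta(2-\vartheta),\quad c_0(\vartheta)=\tfrac{(1-\vartheta)(2-\vartheta)}{2},$$ and set $$G_0(\alpha_1,\alpha_2,\vartheta)=\sum_{r=0}^{2}c_{-r}(\vartheta)\,e^{-r\,p(\alpha_1,\alpha_2)},\qquad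 G(\alpha_1,\alpha_2,\vartheta,\Delta\tau)=1-\Delta\tau\,G_0(\alpha_1,\alpha_2,\vartheta)\quad(\Delta\tau>0).$$ ($G$ is the amplification factor of the tangential Fourier mode $e^{\mathbf{i}\alpha_1 y/h}e^{\mathbf{i}\alpha_2 z/h}$ under one relaxation of the ghost values.) *)

(* Defs.v *)
From mathcomp Require Import all_boot all_order all_algebra.
From mathcomp Require Import all_classical all_reals all_analysis.
From mathcomp Require Import ring lra.

Set Implicit Arguments.
Unset Strict Implicit.
Unset Printing Implicit Defensive.

Import Order.TTheory GRing.Theory Num.Theory.

Local Open Scope classical_set_scope.
Local Open Scope ring_scope.

(* Set-valued, so that [argmin D f = [set x]] says that x is the unique
   minimizer of f over D. *)
Definition argmin {T : Type} {d : Order.disp_t} {S : porderType d}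
    (D : set T) (f : T -> S) : set T :=
  [set x | D x /\ forall y, D y -> (f x <= f y)%O].

Section Hyperbolic.
Context {R : realType}.
Implicit Types x y : R.

Definition cosh x : R := (expR x + expR (- x)) / 2.

Definition acosh : R -> R := 'pinv_(fun=> 0) [set t : R | 0 <= t] cosh.

Lemma cosh_bij : set_bij [set t : R | 0 <= t] [set x : R | 1 <= x] cosh.
Proof.
split.
- move=> x /= x0; rewrite /cosh expRN.
  have e0 := expR_gt0 x.
  have : 0 <= (expR x - 1) ^+ 2 / expR x by rewrite divr_ge0 ?sqr_ge0 ?ltW.
  have -> : (expR x - 1) ^+ 2 / expR x = expR x + (expR x)^-1 - 2.
    by field; rewrite gt_eqF.
  lra.
- move=> x y /set_mem /= x0 /set_mem /= y0; rewrite /cosh !expRN => exy.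
  apply: expR_inj; have ex := expR_gt0 x; have ey := expR_gt0 y.
  have ex1 : 1 <= expR x by rewrite -expR0 ler_expR.
  have ey1 : 1 <= expR y by rewrite -expR0 ler_expR.
  have : (expR x - expR y) * (expR x * expR y - 1) = 0.
    have -> : (expR x - expR y) * (expR x * expR y - 1) =
      expR x * expR y * 2 * ((expR x + (expR x)^-1) / 2
        - (expR y + (expR y)^-1) / 2) by field; rewrite !gt_eqF.
    by rewrite exy subrr mulr0.
  by move/eqP; rewrite mulf_eq0 => /orP[|] /eqP; nra.
- move=> x /= x1.
  pose s := Num.sqrt (x ^+ 2 - 1).
  have s2 : s ^+ 2 = x ^+ 2 - 1 by rewrite sqr_sqrtr // subr_ge0 exprn_ege1.
  have s0 : 0 <= s by exact: sqrtr_ge0.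
  have xs0 : 0 < x + s by lra.
  exists (ln (x + s)); first by apply: ln_ge0; lra.
  rewrite /cosh expRN lnK ?posrE //.
  have -> : (x + s)^-1 = x - s.
    apply: (mulfI (lt0r_neq0 xs0)); rewrite divff ?lt0r_neq0 //.
    by rewrite mulrC -subr_sqr s2; ring.
  by field.
Qed.

Lemma acosh_ge0 x : 1 <= x -> 0 <= acosh x.
Proof.
by move=> x1; have [h _ _] := bijpinv_bij (fun=> 0) cosh_bij; exact: h.
Qed.

Lemma acoshK x : 1 <= x -> cosh (acosh x) = x.
Proof.
by move=> x1; have [_ _ s] := cosh_bij; apply: (surjpK _ s); exact: mem_set.
Qed.

End Hyperbolic.

Section AmplificationFactor.
Context {R : realType}.
Implicit Types (alpha theta dtau : R).

Definition LOW : set (R * R) := `[0, pi / 2] `*` `[0, pi / 2].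

Definition HIGH : set (R * R) := (`[0, pi] `*` `[0, pi]) `\` LOW.

Definition decay alpha1 alpha2 : R := acosh (3 - cos alpha1 - cos alpha2).

(* [dirichlet_coef theta r] is the coefficient with index -r. *)
Definition dirichlet_coef theta (r : nat) : R :=
  match r with
  | 0 => (1 - theta) * (2 - theta) / 2
  | 1 => theta * (2 - theta)
  | 2 => theta * (theta - 1) / 2
  | _ => 0
  end.

Definition G0 alpha1 alpha2 theta : R :=
  \sum_(0 <= r < 3) dirichlet_coef theta r * expR (- r%:R * decay alpha1 alpha2).

Definition G alpha1 alpha2 theta dtau : R := 1 - dtau * G0 alpha1 alpha2 theta.

(* The supremum is taken in the extended reals, where it always exists. *)
Definition sup_HIGH theta dtau : \bar R :=
  ereal_sup [set (`|G q.1 q.2 theta dtau|)%:E | q in HIGH].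

Definition dtau_opt theta : set R :=
  argmin [set dtau : R | 0 < dtau] (sup_HIGH theta).

Definition G0min theta : R :=
  Num.min `|G0 (pi / 2) 0 theta|
    (Num.min `|G0 (pi / 2) (pi / 2) theta| `|G0 pi pi theta|).

Definition G0max theta : R :=
  Num.max `|G0 (pi / 2) 0 theta|
    (Num.max `|G0 (pi / 2) (pi / 2) theta| `|G0 pi pi theta|).

End AmplificationFactor.

(* Main.v *)
Require Import Defs.
From mathcomp Require Import all_boot all_order all_algebra.
From mathcomp Require Import all_classical all_reals all_analysis.
From mathcomp Require Import ring lra.

Import Order.TTheory GRing.Theory Num.Theory.

Local Open Scope classical_set_scope.
Local Open Scope ring_scope.

(** On a Fourier mode, [G0] depends only on the decay factor [x = exp (- p)],
    which is the root in ]0, 1] of [x + 1 / x = 2 s] for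
    [s = 3 - cos alpha1 - cos alpha2], and it is a quadratic polynomial in [x]
    with Dirichlet coefficients.  This polynomial is positive and nondecreasing
    on [0, 1] ([dirichlet_poly_gt0], [dirichlet_poly_le]), whereas [x] decreases
    with [s] ([joukowsky_le]).  On HIGH at least one cosine is negative and the
    other is at most 1, so [s] ranges over ]2, 5]: the least value of [G0] is attained at
    [(pi, pi)], where [s = 5], and its supremum is the value at [(pi / 2, 0)],
    where [s = 2].  This last point lies in LOW, so the supremum is only
    approached, along the modes [(alpha, 0)] with [alpha] decreasing to
    [pi / 2].

    With [m] and [M] these two values, [t |-> `|1 - dtau * t|] is convex, so its
    supremum over HIGH is the larger of its values at [m] and [M]
    ([sup_HIGHE]).  The function [1 - dtau * m] strictly decreases in [dtau] and
    [dtau * M - 1] strictly increases; they cross at [2 / (m + M)], which is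
    therefore the unique minimizer ([argmin_max_affine]). *)

(** * Optimal relaxation for an interval of eigenvalues *)

Section Relaxation.
Context {R : realType}.
Implicit Types m M t dtau : R.

Lemma norm_affine_le_max m M dtau t : 0 <= dtau -> m <= t -> t <= M ->
  `|1 - dtau * t| <= Num.max `|1 - dtau * m| `|1 - dtau * M|.
Proof.
move=> dtau0 mt tM.
have h1 : dtau * m <= dtau * t by rewrite ler_wpM2l.
have h2 : dtau * t <= dtau * M by rewrite ler_wpM2l.
rewrite le_max; apply/orP; case: (leP 0 (1 - dtau * t)) => h.
  by left; rewrite !ger0_norm; lra.
by right; rewrite !ltr0_norm; lra.
Qed.

(** Moving [dtau] below the crossing point raises [1 - dtau * m], and moving it
    above raises [dtau * M - 1], strictly because [m] and [M] are positive. *)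
Lemma argmin_max_affine m M : 0 < m -> m <= M ->
  argmin [set dtau : R | 0 < dtau]
    (fun dtau => (Num.max `|1 - dtau * m| `|1 - dtau * M|)%:E)
  = [set 2 / (m + M)].
Proof.
move=> m0 mM; set s := 2 / (m + M).
have mMn0 : m + M != 0 by rewrite gt_eqF; lra.
have s0 : 0 < s by rewrite divr_gt0; lra.
have sE : s * m + s * M = 2 by rewrite -mulrDr divfK.
have smM : s * m <= s * M by rewrite ler_pM2l.
have maxs : Num.max `|1 - s * m| `|1 - s * M| = 1 - s * m.
  have -> : 1 - s * M = - (1 - s * m) by lra.
  by rewrite normrN maxxx ger0_norm; lra.
have below dtau : dtau < s ->
    1 - s * m < Num.max `|1 - dtau * m| `|1 - dtau * M|.
  move=> ds; rewrite lt_max (lt_le_trans _ (ler_norm _)) //.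
  by have : dtau * m < s * m; [rewrite ltr_pM2r | lra].
have above dtau : s < dtau ->
    1 - s * m < Num.max `|1 - dtau * m| `|1 - dtau * M|.
  move=> ds; rewrite lt_max [X in _ || X](_ : _ = true) ?orbT //.
  rewrite distrC (lt_le_trans _ (ler_norm _)) //.
  by have : s * M < dtau * M; [rewrite ltr_pM2r//; lra | lra].
apply/seteqP; split=> [dtau [/= _ /(_ s s0)]|_ ->] /=.
  rewrite lee_fin maxs => dtau_min.
  by case: (ltgtP dtau s) => // [/below|/above]; rewrite ltNge dtau_min.
split=> // dtau _; rewrite lee_fin maxs.
case: (ltgtP dtau s) => [/below/ltW|/above/ltW|->] //.
by rewrite maxs.
Qed.

End Relaxation.

(** * The decay factor *)

Section DecayFactor.
Context {R : realType}.
Implicit Types s x y : R.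

(** The difference of the two sides of the hypothesis is
    [(y - x) * (1 - 1 / (x * y))], whose second factor is nonpositive. *)
Lemma joukowsky_le x y : 0 < x <= 1 -> 0 < y <= 1 ->
  x + x^-1 <= y + y^-1 -> y <= x.
Proof.
move=> /andP[x0 x1] /andP[y0 y1] h; rewrite leNgt; apply/negP => xy.
have xy0 : 0 < x * y by rewrite mulr_gt0.
have : 0 <= (y + y^-1 - (x + x^-1)) * (x * y).
  by rewrite mulr_ge0 ?subr_ge0// ltW.
have -> : (y + y^-1 - (x + x^-1)) * (x * y) = (y - x) * (x * y - 1).
  by field; rewrite !gt_eqF.
have : x * y < 1 by nra.
by nra.
Qed.

Definition decay_factor s : R := expR (- acosh s).

Lemma decay_factor_itv s : 1 <= s -> 0 < decay_factor s <= 1.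
Proof.
by move=> s1; rewrite expR_gt0/= -expR0 ler_expR oppr_le0 acosh_ge0.
Qed.

Lemma decay_factorE s : 1 <= s ->
  decay_factor s + (decay_factor s)^-1 = 2 * s.
Proof.
move=> s1; rewrite -[in RHS](acoshK s1) /decay_factor -expRN opprK /cosh.
by field.
Qed.

Lemma decay_factor_le s1 s2 : 1 <= s1 -> s1 <= s2 ->
  decay_factor s2 <= decay_factor s1.
Proof.
move=> s1_ge1 s12; have s2_ge1 := le_trans s1_ge1 s12.
apply: joukowsky_le; rewrite ?decay_factor_itv// !decay_factorE//.
by rewrite ler_pM2l.
Qed.

Lemma decay_factor_eq s x : 0 < x <= 1 -> x + x^-1 = 2 * s ->
  decay_factor s = x.
Proof.
move=> xP xE; have /andP[x0 x1] := xP.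
have s1 : 1 <= s.
  have : 0 <= (1 - x) ^+ 2 / x by rewrite divr_ge0 ?sqr_ge0 ?ltW.
  have -> : (1 - x) ^+ 2 / x = x + x^-1 - 2 by field; rewrite gt_eqF.
  by rewrite xE; lra.
have E := decay_factorE _ s1; rewrite -xE in E.
apply/eqP; rewrite eq_le.
by apply/andP; split; apply: joukowsky_le; rewrite ?decay_factor_itv// E.
Qed.

(** Strictness holds because the equation of the decay factor determines [s]. *)
Lemma decay_factor_lt s1 s2 : 1 <= s1 -> s1 < s2 ->
  decay_factor s2 < decay_factor s1.
Proof.
move=> s1_ge1 s12; rewrite lt_neqAle decay_factor_le// ?ltW// andbT.
apply/eqP => E.
have := decay_factorE _ s1_ge1; rewrite -E decay_factorE; lra.
Qed.

End DecayFactor.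

(** * The Dirichlet polynomial *)

Section DirichletPolynomial.
Context {R : realType}.
Implicit Types theta x y a b : R.

Definition dirichlet_poly theta x : R :=
  \sum_(0 <= r < 3) dirichlet_coef theta r * x ^+ r.

Lemma dirichlet_polyE theta x : dirichlet_poly theta x =
  (1 - theta) * (2 - theta) / 2 + theta * (2 - theta) * x
  + theta * (theta - 1) / 2 * x ^+ 2.
Proof.
by rewrite /dirichlet_poly !big_nat_recr//= big_geq// add0r expr0 mulr1 expr1.
Qed.

Lemma G0E a b theta :
  G0 a b theta = dirichlet_poly theta (decay_factor (3 - cos a - cos b)).
Proof.
apply: eq_bigr => r _; congr (_ * _).
by rewrite /decay_factor -expRM_natl mulrN mulNr.
Qed.

(** The difference quotient is
    [theta * (2 - theta - (1 - theta) * (x + y) / 2)], and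
    [2 - theta - (1 - theta) = 1]. *)
Lemma dirichlet_poly_le theta x y : 0 <= theta < 1 -> x <= y -> y <= 1 ->
  dirichlet_poly theta x <= dirichlet_poly theta y.
Proof.
move=> /andP[t0 t1] xy y1; rewrite -subr_ge0 !dirichlet_polyE.
set d := (X in 0 <= X).
have -> : d = (y - x) * (theta * (1 + (1 - theta) * (1 - (x + y) / 2))).
  by rewrite /d; field.
rewrite !mulr_ge0 ?subr_ge0// addr_ge0// mulr_ge0//; lra.
Qed.

(** The difference quotient is at most [theta * (2 - theta)], that is
    [1 - (1 - theta) ^ 2]. *)
Lemma dirichlet_poly_nonexpansive theta x y : 0 <= theta < 1 ->
  0 <= x -> x <= y -> dirichlet_poly theta y - dirichlet_poly theta x <= y - x.
Proof.
move=> /andP[t0 t1] x0 xy; rewrite -subr_ge0 !dirichlet_polyE.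
set d := (X in 0 <= X).
have -> : d = (y - x) *
    ((1 - theta) ^+ 2 + theta * ((1 - theta) * ((x + y) / 2))).
  by rewrite /d; field.
rewrite mulr_ge0 ?subr_ge0// addr_ge0 ?sqr_ge0// !mulr_ge0//; lra.
Qed.

Lemma dirichlet_poly_gt0 theta x : 0 <= theta < 1 -> 0 <= x <= 1 ->
  0 < dirichlet_poly theta x.
Proof.
move=> ht /andP[x0 x1]; have /andP[t0 t1] := ht.
apply: (@lt_le_trans _ _ (dirichlet_poly theta 0)).
  rewrite dirichlet_polyE expr0n/= !mulr0 !addr0.
  by rewrite divr_gt0// mulr_gt0//; lra.
exact: dirichlet_poly_le.
Qed.

End DirichletPolynomial.

(** * The amplification factor on the high frequencies *)

Section HighFrequencies.
Context {R : realType}.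
Implicit Types theta dtau a b : R.

Lemma HIGH_sum_cos a b : HIGH (a, b) -> 2 <= 3 - cos a - cos b <= 5.
Proof.
rewrite /HIGH /LOW /= !in_itv /= => -[[/andP[a0 api] /andP[b0 bpi]] nlow].
have ca := cos_geN1 a; have cb := cos_geN1 b.
have ca1 := cos_le1 a; have cb1 := cos_le1 b.
have neg x : 0 <= x <= pi -> pi / 2 < x -> cos x <= 0 :> R.
  move=> /andP[x0 xpi] hx; rewrite -[leRHS]cos_pihalf; have := pi_gt0 R => p0.
  by rewrite ltW// ltr_cos ?in_itv/= ?x0//; lra.
have [ha|ha] := ltP (pi / 2) a.
  by have := neg a; rewrite a0 api => /(_ isT ha); lra.
have [hb|hb] := ltP (pi / 2) b.
  by have := neg b; rewrite b0 bpi => /(_ isT hb); lra.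
by exfalso; apply: nlow; rewrite a0 b0.
Qed.

Lemma HIGH_pi_pi : HIGH (pi : R, pi : R).
Proof.
have p0 := pi_gt0 R.
rewrite /HIGH /LOW /= !in_itv /= lexx ltW//; split=> // -[/andP[_]].
by lra.
Qed.

(** For [alpha2 = 0] the decay parameter is [2 - cos alpha1], which sweeps
    ]2, 3] as [alpha1] runs over ]pi / 2, pi]. *)
Lemma HIGH_acos s : 2 < s <= 3 ->
  HIGH (acos (2 - s), 0 : R) /\ 3 - cos (acos (2 - s)) - cos 0 = s.
Proof.
move=> /andP[s2 s3].
have s_itv : -1 <= 2 - s <= 1 by apply/andP; split; lra.
have cosE : cos (acos (2 - s)) = 2 - s by rewrite acosK// in_itv.
have p0 := pi_gt0 R.
split; last by rewrite cosE cos0; lra.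
rewrite /HIGH /LOW /= !in_itv /= lexx (ltW p0) acos_ge0// acos_lepi//.
split=> // -[/andP[_ acos_le] _].
have : 0 <= cos (acos (2 - s)).
  apply: cos_ge0_pihalf; rewrite acos_le andbT.
  by have := acos_ge0 s_itv; lra.
by rewrite cosE; lra.
Qed.

Lemma G0_pi_pi theta : G0 pi pi theta = dirichlet_poly theta (decay_factor (5 : R)).
Proof. by rewrite G0E cospi; congr (dirichlet_poly _ (decay_factor _)); ring. Qed.

Lemma G0_pihalf_0 theta :
  G0 (pi / 2) 0 theta = dirichlet_poly theta (decay_factor (2 : R)).
Proof.
by rewrite G0E cos_pihalf cos0; congr (dirichlet_poly _ (decay_factor _)); ring.
Qed.

Lemma G0_bounds theta a b : 0 <= theta < 1 -> 2 <= 3 - cos a - cos b <= 5 ->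
  G0 pi pi theta <= G0 a b theta <= G0 (pi / 2) 0 theta.
Proof.
move=> ht /andP[s2 s5]; rewrite G0_pi_pi G0_pihalf_0 G0E.
have le1 (s : R) : 1 <= s -> decay_factor s <= 1.
  by move=> /decay_factor_itv/andP[].
by rewrite !dirichlet_poly_le//; (apply: le1 || apply: decay_factor_le); lra.
Qed.

Lemma G0_gt0 theta a b : 0 <= theta < 1 -> 0 < G0 a b theta.
Proof.
move=> ht; rewrite G0E dirichlet_poly_gt0//.
have /decay_factor_itv/andP[/ltW-> ->]// : 1 <= 3 - cos a - cos b.
by have := cos_le1 a; have := cos_le1 b; lra.
Qed.

(** The value at [(pi / 2, 0)] is not attained on HIGH, but on the edge
    [alpha2 = 0] decay factors arbitrarily close to that of [(pi / 2, 0)]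
    occur, and [G0] is 1-Lipschitz in the decay factor. *)
Lemma HIGH_approx_pihalf_0 theta e : 0 <= theta < 1 -> 0 < e ->
  exists2 a, HIGH (a, 0) &
    G0 (pi / 2) 0 theta - e <= G0 a 0 theta <= G0 (pi / 2) 0 theta.
Proof.
move=> ht e0; set x2 := decay_factor (2 : R); set x3 := decay_factor (3 : R).
have /andP[x20 x21] : 0 < x2 <= 1 by apply: decay_factor_itv; lra.
have x3P : 0 < x3 <= 1 by apply: decay_factor_itv; lra.
have /andP[x30 x31] := x3P.
have x32 : x3 < x2 by apply: decay_factor_lt; lra.
(* The lower bound [x3] keeps the decay parameter of [x] in ]2, 3]. *)
pose x := Num.max x3 (x2 - e).
have xx2 : x < x2 by rewrite gt_max x32/=; lra.
have x3x : x3 <= x by rewrite le_max lexx.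
have x2ex : x2 - e <= x by rewrite le_max lexx orbT.
have xP : 0 < x <= 1 by apply/andP; split; lra.
pose s := (x + x^-1) / 2.
have xE : x + x^-1 = 2 * s by rewrite /s; field; rewrite gt_eqF; lra.
have sE : decay_factor s = x by apply: decay_factor_eq.
have E2 : x2 + x2^-1 = 2 * 2 by apply: decay_factorE; lra.
have E3 : x3 + x3^-1 = 2 * 3 by apply: decay_factorE; lra.
have sP : 2 < s <= 3.
  have x2P : 0 < x2 <= 1 by rewrite x20.
  apply/andP; split.
    rewrite ltNge; apply/negP => s2.
    have : x2 <= x by apply: joukowsky_le => //; rewrite E2 xE; lra.
    by lra.
  have /andP[x0 x1] := xP.
  rewrite leNgt; apply/negP => s3.
  have xx3 : x <= x3 by apply: joukowsky_le => //; rewrite E3 xE; lra.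
  have xx : x = x3 by apply/eqP; rewrite eq_le xx3.
  by move: s3 xE; rewrite xx E3; lra.
have [aH aE] := HIGH_acos _ sP; exists (acos (2 - s)) => //.
rewrite G0_pihalf_0 G0E aE sE -/x2 dirichlet_poly_le ?andbT// ?(ltW xx2)//.
have := @dirichlet_poly_nonexpansive _ theta x x2 ht.
by move=> /(_ (ltW (lt_le_trans x30 x3x)) (ltW xx2)); lra.
Qed.

Lemma sup_HIGHE theta dtau : 0 <= theta < 1 -> 0 < dtau ->
  sup_HIGH theta dtau = (Num.max `|1 - dtau * G0 pi pi theta|
                                 `|1 - dtau * G0 (pi / 2) 0 theta|)%:E.
Proof.
move=> ht dtau0; apply/eqP; rewrite eq_le; apply/andP; split.
  apply: ge_ereal_sup => _ [[a b] /HIGH_sum_cos abH <-].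
  have /andP[h1 h2] := G0_bounds _ _ _ ht abH.
  by rewrite lee_fin norm_affine_le_max// ltW.
rewrite EFin_max ge_max; apply/andP; split.
  by apply: ereal_sup_ubound; exists (pi, pi) => //; exact: HIGH_pi_pi.
apply/lee_addgt0Pr => e e0.
(* [dtau] is the Lipschitz constant of [G] as a function of [G0]. *)
have [a aH /andP[h1 h2]] := HIGH_approx_pihalf_0 _ _ ht (divr_gt0 e0 dtau0).
apply: (@le_trans _ _ ((`|G a 0 theta dtau|)%:E + e%:E)%E); last first.
  by apply: leeD => //; apply: ereal_sup_ubound; exists (a, 0).
rewrite -EFinD lee_fin -lerBlDl (le_trans (lerB_dist _ _))// /G.
rewrite opprB addrC subrKA -mulrBr normrM gtr0_norm// mulrC -ler_pdivlMr//.
by rewrite ler_norml; lra.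
Qed.

Lemma G0min_eq theta : 0 <= theta < 1 -> G0min theta = G0 pi pi theta.
Proof.
move=> ht; rewrite /G0min !gtr0_norm ?G0_gt0//.
have h1 : G0 pi pi theta <= G0 (pi / 2) (pi / 2) theta.
  by have /andP[] := G0_bounds theta (pi / 2) (pi / 2) ht
    ltac:(rewrite cos_pihalf; lra).
have h2 : G0 pi pi theta <= G0 (pi / 2) 0 theta.
  by have /andP[] := G0_bounds theta (pi / 2) 0 ht
    ltac:(rewrite cos_pihalf cos0; lra).
by rewrite (min_r h1) (min_r h2).
Qed.

Lemma G0max_eq theta : 0 <= theta < 1 -> G0max theta = G0 (pi / 2) 0 theta.
Proof.
move=> ht; rewrite /G0max !gtr0_norm ?G0_gt0//.
have /andP[h1 h2] := G0_bounds theta (pi / 2) (pi / 2) ht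
  ltac:(rewrite cos_pihalf; lra).
by rewrite (max_l h1) (max_l h2).
Qed.

End HighFrequencies.

Theorem proposition3 (R : realType) (theta : R) (htheta : 0 <= theta < 1) :
  dtau_opt theta = [set 2 / (G0min theta + G0max theta)].
Proof.
rewrite G0min_eq// G0max_eq// -argmin_max_affine ?G0_gt0//; last first.
  by have /andP[] := G0_bounds theta (pi / 2) 0 htheta
    ltac:(rewrite cos_pihalf cos0; lra).
rewrite /dtau_opt /argmin; apply/seteqP; split=> dtau /= [dtau0 dtau_min].
  by split=> // y y0; rewrite -!sup_HIGHE//; exact: dtau_min.
by split=> // y y0; rewrite !sup_HIGHE//; exact: dtau_min.
Qed.
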